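(* Let $(X,Y)$ be a pair of real random variables with marginal distribution functions $F$ (of $X$) and $G$ (of $Y$), and write $\bar F=1-F$, $\bar G=1-G$. Assume: (1) $\sup\{x: F(x)<1\}=\infty$, and $F\in MDA(\Lambda)$ with auxiliary function $f$; (2) $\lim_{x\to\infty}\bar G(x)/\bar F(x)=c$ with $c\in(0,\infty)$; (3) for all $t>0$, $\lim_{x\to\infty}P(|Y|>t f(x)\mid X>x)=0$; (4) for all $t>0$, $\lim_{x\to\infty}P(|X|>t f(x)\mid Y>x)=0$; (5) for some $L>0$, $\lim_{x\to\infty}\dfrac{P(Y>Lf(x),\,X>Lf(x))}{P(X>x)}=0$. Then both $F$ and $G$ belong to $MDA(\Lambda)$, and $X$ and $Y$ are asymptotically independent.
   Context: $MDA(\Lambda)$ is the maximal domain of attraction of the Gumbel distribution $\Lambda(x)=\exp\{-e^{-x}\}$: the class of distribution functions $F$ for which there exist $a_n>0$, $b_n\in\mathbb{R}$ with $\lim_{n\to\infty}n\bar F(a_nx+b_n)=e^{-x}$ for all $x\in\mathbb{R}$, where $\bar F=1-F$. When $F$ has infinite right endpoint, $F\in MDA(\Lambda)$ is equivalent to the existence of an auxiliary function $f$: a positive function with derivative converging to $0$ at infinity, self-neglecting (i.e. $\lim_{t\to\infty}f(t+xf(t))/f(t)=1$ for all $x\in\mathbb{R}$), such that $\lim_{t\to\infty}\bar F(t+xf(t))/\bar F(t)=e^{-x}$ for all $x\in\mathbb{R}$. The function $f$ in the claim is such an auxiliary function of $F$. Random variables $X,Y$ with joint distribution function $H$, each in a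 maximal domain of attraction with norming constants $a_n^{(1)}>0,b_n^{(1)}$ and $a_n^{(2)}>0,b_n^{(2)}$ respectively, are asymptotically independent if for all $(x_1,x_2)$, $\lim_{n\to\infty}H^n(a_n^{(1)}x_1+b_n^{(1)},\,a_n^{(2)}x_2+b_n^{(2)})=G_1(x_1)G_2(x_2)$, where $G_1,G_2$ are non-degenerate extreme value distributions. *)

(* Defs.v *)
From HB Require Import structures.
From mathcomp Require Import all_boot all_order all_algebra.
From mathcomp Require Import all_classical all_reals all_analysis.

Set Implicit Arguments.
Unset Strict Implicit.
Unset Printing Implicit Defensive.

Import Order.TTheory GRing.Theory Num.Theory.
Import numFieldNormedType.Exports.

Local Open Scope classical_set_scope.
Local Open Scope ring_scope.

Section DistributionFunctions.
Context {R : realType}.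

Definition is_distribution_function (F : R -> R) : Prop :=
  [/\ {homo F : x y / x <= y}, right_continuous F,
      F x @[x --> -oo] --> (0 : R) & F x @[x --> +oo] --> (1 : R)].

Definition tail (F : R -> R) (x : R) : R := 1 - F x.

Definition right_endpoint (F : R -> R) : \bar R :=
  ereal_sup [set x%:E | x in [set x | F x < 1]].

Definition gumbel (x : R) : R := expR (- expR (- x)).

Definition frechet (alpha x : R) : R :=
  if 0 < x then expR (- (x `^ (- alpha))) else 0.

Definition weibull (alpha x : R) : R :=
  if x <= 0 then expR (- ((- x) `^ alpha)) else 1.

Definition standard_evd (G : R -> R) : Prop :=
  [\/ G = gumbel,
      exists2 alpha, 0 < alpha & G = frechet alpha
    | exists2 alpha, 0 < alpha & G = weibull alpha].

(* Up to location and scale.  All these laws are non-degenerate, and they are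
   continuous, so that convergence in law to them is pointwise convergence of
   distribution functions on the whole line. *)
Definition extreme_value_distribution (G : R -> R) : Prop :=
  exists (G0 : R -> R) (s m : R), [/\ standard_evd G0, 0 < s
    & forall x, G x = G0 ((x - m) / s)].

Definition MDA_gumbel (F : R -> R) : Prop :=
  is_distribution_function F /\
  exists a b : nat -> R, (forall n, 0 < a n) /\
    forall x : R, n%:R * tail F (a n * x + b n) @[n --> \oo] --> expR (- x).

Definition self_neglecting (f : R -> R) : Prop :=
  forall x : R, f (t + x * f t) / f t @[t --> +oo] --> (1 : R).

(* An auxiliary function matters, and need only be defined, near +oo; its
   values elsewhere are left unconstrained. *)
Definition auxiliary_function (F f : R -> R) : Prop :=
  [/\ \forall t \near +oo, 0 < f t,
      \forall t \near +oo, derivable f t 1,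
      derive1 f t @[t --> +oo] --> (0 : R),
      self_neglecting f
    & forall x : R, tail F (t + x * f t) / tail F t @[t --> +oo] --> expR (- x)].

(* [F] is in the maximal domain of attraction of [G], with norming constants
   [a] and [b]. *)
Definition attracted (F G : R -> R) (a b : nat -> R) : Prop :=
  [/\ extreme_value_distribution G, forall n, 0 < a n
    & forall x : R, F (a n * x + b n) ^+ n @[n --> \oo] --> G x].

End DistributionFunctions.

Section RandomPairs.
Context {d : measure_display} {T : measurableType d} {R : realType}.
Variable P : probability T R.

Definition prob (A : set T) : R := fine (P A).

Definition cond_prob (A B : set T) : R := prob (A `&` B) / prob B.

Definition df (X : {RV P >-> R}) (x : R) : R := fine (cdf X x).

Definition joint_df (X Y : {RV P >-> R}) (x y : R) : R :=
  prob [set w | X w <= x /\ Y w <= y].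

(* By the convergence of types theorem, the limit relation does not depend on
   the choice of the norming constants; it is required for every choice, and
   such a choice is required to exist. *)
Definition asymptotically_independent (X Y : {RV P >-> R}) : Prop :=
  [/\ exists G1 a1 b1, attracted (df X) G1 a1 b1,
      exists G2 a2 b2, attracted (df Y) G2 a2 b2
    & forall G1 G2 a1 b1 a2 b2,
        attracted (df X) G1 a1 b1 -> attracted (df Y) G2 a2 b2 ->
        forall x1 x2 : R,
          joint_df X Y (a1 n * x1 + b1 n) (a2 n * x2 + b2 n) ^+ n
            @[n --> \oo] --> G1 x1 * G2 x2].

End RandomPairs.

(* Main.v *)
(* Since f' -> 0, eventually f(x) <= x, so P(X > x, Y > x) = o(P(X > x)) by
   [Y_given_X].  For thresholds u_n, v_n such that F(u_n)^n and G(v_n)^n have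
   positive limits, n P(X > u_n) and n P(Y > v_n) are bounded; by [tail_ratio]
   so is n P(X > m_n) with m_n = min(u_n, v_n), and therefore
   n P(X > u_n, Y > v_n) -> 0.  Finally
     |H^n - (F G)^n| <= n |H - F G| <= n P(X > u_n, Y > v_n) + n (1 - F) (1 - G)
   tends to 0.  When one of the limits is 0, H <= min(F, G) suffices.  The
   particular norming constants and limit laws play no role.  Adding a_n ln c
   to the centering constants of F gives norming constants for G. *)

Require Import Defs.
From mathcomp Require Import all_boot all_order all_algebra.
From mathcomp Require Import all_classical all_reals all_analysis.
From mathcomp Require Import ring lra.

Import Order.TTheory GRing.Theory Num.Theory.
Import numFieldNormedType.Exports.

Local Open Scope classical_set_scope.
Local Open Scope ring_scope.

(** * Elementary estimates on powers and exponentials *)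

(** Induction by telescoping: each step adds one factor [a - b], and all other factors lie in the
    unit interval. *)
Lemma ler_norm_subXX (R : realDomainType) (a b : R) (n : nat) :
  0 <= a <= 1 -> 0 <= b <= 1 -> `|a ^+ n - b ^+ n| <= n%:R * `|a - b|.
Proof.
move=> /andP[a0 a1] /andP[b0 b1]; elim: n => [|n IHn].
  by rewrite !expr0 subrr normr0 mul0r.
have -> : a ^+ n.+1 - b ^+ n.+1 = a * (a ^+ n - b ^+ n) + (a - b) * b ^+ n.
  by rewrite !exprS; ring.
rewrite (le_trans (ler_normD _ _))// !normrM -natr1 mulrDl mul1r lerD//.
  by rewrite (ger0_norm a0) (le_trans _ IHn)// ler_piMl.
by rewrite ler_piMr// ger0_norm ?exprn_ge0// exprn_ile1.
Qed.

(** One side is [1 - x <= expR (- x)]; the other is [expR (- x) <= 1 / (1 + x) <= 1 - x + x ^+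
    2]. *)
Lemma norm_sub_expRN_le (R : realType) (x : R) :
  0 <= x -> `|1 - x - expR (- x)| <= x ^+ 2.
Proof.
move=> x0; have := expR_ge1Dx (- x); have := expR_ge1Dx x.
set e := expR (- x) => ex eNx.
have e0 : 0 < e by rewrite expR_gt0.
have eM : e * expR x = 1 by rewrite /e expRN mulVf ?gt_eqF ?expR_gt0.
have e1 : e * (1 + x) <= e * expR x by rewrite ler_pM2l.
rewrite eM in e1.
have ub : e <= 1 - x + x ^+ 2.
  (* After multiplication by [1 + x] the right side is [1 + x ^+ 3], while the left side is at most
     1. *)
  rewrite -(@ler_pM2r _ (1 + x)); last by lra.
  have : 0 <= x ^+ 3 by exact: exprn_ge0.
  have -> : (1 - x + x ^+ 2) * (1 + x) = 1 + x ^+ 3 by ring.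
  lra.
by rewrite ler_norml; apply/andP; split; lra.
Qed.

Lemma cvg_to0_bounded_natr (R : realType) (u : nat -> R) (M : R) :
  (forall n, 0 <= u n) -> (\forall n \near \oo, n%:R * u n <= M) ->
  u n @[n --> \oo] --> (0 : R).
Proof.
move=> u0 uM.
have M0 : M * n%:R^-1 @[n --> \oo] --> (0 : R).
  rewrite -[0](mulr0 M); apply: cvgM; first exact: cvg_cst.
  apply/gtr0_cvgV0; last exact: cvgr_idn.
  by near=> n; rewrite ltr0n; near: n; exact: nbhs_infty_gt.
apply: (squeeze_cvgr _ (cvg_cst _) M0).
near=> n; rewrite u0/= ler_pdivlMr; last first.
  by rewrite ltr0n; near: n; exact: nbhs_infty_gt.
by rewrite mulrC; near: n.
Unshelve. all: by end_near. Qed.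

Lemma cvg_natrM_bounded (R : realType) (u : nat -> R) (l : R) :
  n%:R * u n @[n --> \oo] --> l -> \forall n \near \oo, n%:R * u n <= l + 1.
Proof. by move=> ul; apply: (cvgr_le l ul); rewrite ltrDl. Qed.

(** The power is compared with [expR (- (n * u n))]. The bases differ by at most [u n ^+ 2], so the
    powers differ by at most [n * u n * u n], which tends to [l * 0]. *)
Lemma cvg_exprn_expR (R : realType) (u : nat -> R) (l : R) :
  (forall n, 0 <= u n <= 1) -> n%:R * u n @[n --> \oo] --> l ->
  (1 - u n) ^+ n @[n --> \oo] --> expR (- l).
Proof.
move=> u01 ul.
have u0 n : 0 <= u n by case/andP: (u01 n).
have nl : expR (- (n%:R * u n)) @[n --> \oo] --> expR (- l).
  by apply: continuous_cvg; [exact: continuous_expR|exact: cvgN].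
have u_to0 := cvg_to0_bounded_natr R u _ u0 (cvg_natrM_bounded R u l ul).
have d0 : (1 - u n) ^+ n - expR (- (n%:R * u n)) @[n --> \oo] --> (0 : R).
  apply: norm_cvg0; apply: (@squeeze_cvgr _ _ _ _ (cst 0)
    (fun n => n%:R * u n * u n)).
  - near=> n; rewrite normr_ge0/= -mulrN expRM_natl.
    have /andP[_ u1] := u01 n; have u0n := u0 n.
    rewrite (le_trans (ler_norm_subXX _ _ _ _ _ _))//.
    + by apply/andP; split; lra.
    + by rewrite expR_ge0 -expR0 ler_expR oppr_le0.
    + by rewrite -mulrA ler_wpM2l// -expr2 norm_sub_expRN_le.
  - exact: cvg_cst.
  - by rewrite -[0](mulr0 l); exact: cvgM.
rewrite -[expR (- l)]add0r.
rewrite (_ : (fun n => _) = (fun n => ((1 - u n) ^+ n - expR (- (n%:R * u n)))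
  + expR (- (n%:R * u n)))); last by apply/funext => n; rewrite subrK.
exact: cvgD.
Unshelve. all: by end_near. Qed.

(* From [F ^ n <= exp (- n (1 - F))]: a positive limit of [F(u_n) ^ n] keeps
   [n (1 - F(u_n))] bounded. *)
Lemma natrM_bounded_of_cvg_exprn (R : realType) (u : nat -> R) (g : R) :
  (forall n, 0 <= u n <= 1) -> 0 < g -> (1 - u n) ^+ n @[n --> \oo] --> g ->
  exists M, \forall n \near \oo, n%:R * u n <= M.
Proof.
(* The power is eventually at least [g / 2], which is positive and so has a logarithm. *)
move=> u01 g0 ug; exists (- ln (g / 2)).
have : \forall n \near \oo, g / 2 <= (1 - u n) ^+ n.
  by apply: (cvgr_ge g ug); lra.
apply: filterS => n gn.
have /andP[_ u1] := u01 n.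
rewrite lerNr -mulrN -ler_expR expRM_natl lnK ?posrE ?divr_gt0//.
rewrite (le_trans gn)// lerXn2r ?nnegrE ?expR_ge0 ?subr_ge0//.
exact: expR_ge1Dx.
Qed.

(** * Growth of the auxiliary function, and tails near infinity *)

(** Once the slope is at most 1/2, the mean value theorem keeps [f] below a line of slope 1/2, and
    the identity eventually overtakes that line. *)
Lemma le_id_derive1_cvg0 (R : realType) (f : R -> R) :
  (\forall t \near +oo, derivable f t 1) ->
  derive1 f t @[t --> +oo] --> (0 : R) ->
  \forall t \near +oo, f t <= t.
Proof.
move=> fd f'0.
have : \forall t \near +oo, derivable f t 1 /\ derive1 f t <= 2^-1.
  by near=> t; split; near: t => //; apply: (cvgr_le 0 f'0); rewrite invr_gt0.
case=> M [_ fM].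
pose t0 := M + 1.
have t0M : M < t0 by rewrite ltrDl.
near=> t.
have tt0 : t0 < t by near: t; apply: nbhs_pinfty_gt; rewrite num_real.
(* From this point on, the line [f t0 + (t - t0) / 2] lies below [t]. *)
have tf : 2 * f t0 - t0 <= t by near: t; apply: nbhs_pinfty_ge; rewrite num_real.
have [||z zin fE] := @MVT _ f (derive1 f) t0 t tt0.
- move=> x /[!in_itv]/= /andP[t0x _].
  by rewrite derive1E; apply/derivableP; apply: (proj1 (fM _ (lt_trans t0M t0x))).
- apply: derivable_within_continuous => x /[!in_itv]/= /andP[t0x _].
  exact: (proj1 (fM _ (lt_le_trans t0M t0x))).
move: zin => /[!in_itv]/= /andP[t0z _].
have f'z := proj2 (fM _ (lt_trans t0M t0z)).
have : derive1 f z * (t - t0) <= 2^-1 * (t - t0).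
  by rewrite ler_wpM2r // subr_ge0 ltW.
by rewrite -fE; lra.
Unshelve. all: by end_near. Qed.

(** The tail at any fixed [A] is positive, so it eventually exceeds the tail at [u n]; monotonicity
    then puts [u n] beyond [A]. *)
Lemma cvg_pinfty_tail (R : realType) (F : R -> R) (u : nat -> R) :
  {homo F : x y / x <= y} -> (forall x, 0 < tail F x) ->
  tail F (u n) @[n --> \oo] --> (0 : R) -> u n @[n --> \oo] --> +oo.
Proof.
move=> Fnd F0 Fu; apply/cvgryPge => A.
have : \forall n \near \oo, tail F (u n) < tail F A by exact: (cvgr_lt 0 Fu).
apply: filterS => n; apply: contraTT; rewrite -ltNge -leNgt => /ltW/Fnd.
by rewrite /tail; lra.
Qed.

(** If [F x >= 1], every point where [F] is below 1 lies to the left of [x], and the endpoint would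
    be finite. *)
Lemma tail_gt0_right_endpoint (R : realType) (F : R -> R) :
  {homo F : x y / x <= y} -> right_endpoint F = +oo%E ->
  forall x, 0 < tail F x.
Proof.
move=> Fnd Foo x; rewrite subr_gt0 ltNge; apply/negP => Fx.
suff : (right_endpoint F <= x%:E)%E by rewrite Foo leye_eq.
apply: ge_ereal_sup => _ /= [y Fy <-]; rewrite lee_fin leNgt.
by apply: contraTN Fy => /ltW/Fnd; rewrite -leNgt; apply: le_trans.
Qed.

(** * Marginal and joint distribution functions of random variables *)

Section RandomPair.
Context (R : realType) (d : measure_display) (T : measurableType d)
  (P : probability T R).
Implicit Types X Y : {RV P >-> R}.

Lemma df_distribution X : is_distribution_function (df X).
Proof.
split.
- by move=> x y xy; rewrite fine_le ?fin_num_measure ?cdf_nondecreasing.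
- move=> x; apply: fine_cvg; rewrite /df fineK ?fin_num_measure//.
  exact: cdf_right_continuous.
- exact/fine_cvg/cvg_cdfNy0.
- exact/fine_cvg/cvg_cdfy1.
Qed.

Lemma measurable_RV_gt X (x : R) : measurable [set w | x < X w].
Proof.
rewrite (_ : [set w | _] = X @^-1` `]x, +oo[%classic); last first.
  by apply/seteqP; split => w /=; rewrite in_itv/= andbT.
by rewrite -[X in measurable X]setTI; exact: measurable_funP.
Qed.

Lemma measurable_RV_le X (x : R) : measurable [set w | X w <= x].
Proof.
rewrite (_ : [set w | _] = ~` [set w | x < X w]); last first.
  by apply/seteqP; split => w /=; rewrite leNgt => /negP.
exact/measurableC/measurable_RV_gt.
Qed.

Lemma probC (A : set T) : measurable A -> prob P (~` A) = 1 - prob P A.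
Proof.
by move=> mA; rewrite /prob probability_setC// fineB// fin_num_measure.
Qed.

Lemma le_prob (A B : set T) :
  measurable A -> measurable B -> A `<=` B -> prob P A <= prob P B.
Proof.
by move=> mA mB AB; rewrite fine_le ?fin_num_measure// le_measure ?inE.
Qed.

Lemma prob_ge0 (A : set T) : 0 <= prob P A.
Proof. exact: fine_ge0. Qed.

Lemma dfE X (x : R) : df X x = prob P [set w | X w <= x].
Proof.
by rewrite /df /cdf /prob; congr fine; congr (P _).
Qed.

Lemma tail_df X (x : R) : tail (df X) x = prob P [set w | x < X w].
Proof.
rewrite /tail dfE -probC; last exact: measurable_RV_le.
by congr prob; apply/seteqP; split => w /=; rewrite ltNge => /negP.
Qed.

Lemma df_itv X (x : R) : 0 <= df X x <= 1.
Proof.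
have := prob_ge0 [set w | x < X w]; rewrite -tail_df subr_ge0 => ->.
by rewrite dfE prob_ge0.
Qed.

Lemma tail_df_itv X (x : R) : 0 <= tail (df X) x <= 1.
Proof.
by have /andP[? ?] := df_itv X x; apply/andP; split; rewrite /tail; lra.
Qed.

Lemma tail_df_anti X (x y : R) : x <= y -> tail (df X) y <= tail (df X) x.
Proof. by have [h _ _ _] := df_distribution X => /h; rewrite /tail; lra. Qed.

(** The joint event is the complement of the union of the two exceedance events. *)
Lemma joint_df_inclusion_exclusion X Y (x y : R) :
  joint_df X Y x y =
    df X x + df Y y - 1 + prob P [set w | x < X w /\ y < Y w].
Proof.
have mX := measurable_RV_gt X x; have mY := measurable_RV_gt Y y.
rewrite /joint_df.
rewrite (_ : [set w | X w <= x /\ _] =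
  ~` ([set w | x < X w] `|` [set w | y < Y w])); last first.
  apply/seteqP; split => w /=; rewrite !leNgt.
    by move=> [/negP ? /negP ?] [].
  by move=> /not_orP[/negP ? /negP ?].
rewrite probC; last exact: measurableU.
have -> : prob P ([set w | x < X w] `|` [set w | y < Y w]) =
  prob P [set w | x < X w] + prob P [set w | y < Y w]
  - prob P [set w | x < X w /\ y < Y w].
  rewrite /prob measureUfinl ?fin_num_measure ?ltey_eq//; last first.
    by rewrite fin_num_measure.
  by rewrite fineB ?fineD ?fin_numD ?fin_num_measure//; exact: measurableI.
by rewrite -!tail_df /tail; ring.
Qed.

Lemma joint_df_itv X Y (x y : R) :
  [/\ 0 <= joint_df X Y x y, joint_df X Y x y <= df X x
    & joint_df X Y x y <= df Y y].
Proof.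
have mX := measurable_RV_le X x; have mY := measurable_RV_le Y y.
rewrite !dfE; split; first exact: prob_ge0.
  by apply: le_prob => //; [exact: measurableI|move=> w []].
by apply: le_prob => //; [exact: measurableI|move=> w []].
Qed.

(** * Negligibility of joint exceedances *)

(* As [f(x) <= x] eventually, [Y > x] forces [|Y| > f(x)]. *)
Lemma joint_tail_negligible X Y (f : R -> R) :
  (\forall x \near +oo, f x <= x) ->
  cond_prob P [set w | f x < `|Y w|] [set w | x < X w]
    @[x --> +oo] --> (0 : R) ->
  prob P [set w | x < X w /\ x < Y w] / tail (df X) x @[x --> +oo] --> (0 : R).
Proof.
move=> fx h; apply: (squeeze_cvgr _ (cvg_cst _) h).
near=> x; rewrite /cond_prob -tail_df.
have /andP[t0 _] := tail_df_itv X x.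
rewrite divr_ge0 ?prob_ge0//= ler_wpM2r ?invr_ge0// le_prob//.
- by apply: measurableI; exact: measurable_RV_gt.
- apply: measurableI; last exact: measurable_RV_gt.
  have mY : measurable_fun setT (fun w => `|Y w|).
    by apply: measurableT_comp => //; exact: measurable_funP.
  rewrite (_ : [set w | _] = (fun w => `|Y w|) @^-1` `]f x, +oo[%classic).
    by rewrite -[X in measurable X]setTI; exact: mY.
  by apply/seteqP; split => w /=; rewrite in_itv/= andbT.
- move=> w [xX xY]; split => //=.
  rewrite (lt_le_trans _ (ler_norm _))// (le_lt_trans _ xY)//.
  by near: x.
Unshelve. all: by end_near. Qed.

(* [P(X > u, Y > v) <= P(X > m, Y > m)] for [m = min(u, v)], and
   [P(X > m) <= P(X > u) + P(X > v)]. *)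
Lemma joint_tail_natrM_cvg0 X Y (u v : nat -> R) (M : R) :
  (forall x, 0 < tail (df X) x) ->
  prob P [set w | x < X w /\ x < Y w] / tail (df X) x @[x --> +oo] --> (0 : R) ->
  u n @[n --> \oo] --> +oo -> v n @[n --> \oo] --> +oo ->
  (\forall n \near \oo, n%:R * tail (df X) (u n) <= M) ->
  (\forall n \near \oo, n%:R * tail (df X) (v n) <= M) ->
  n%:R * prob P [set w | u n < X w /\ v n < Y w] @[n --> \oo] --> (0 : R).
Proof.
move=> tX J uoo voo uM vM.
pose m n := Num.min (u n) (v n).
pose q x := prob P [set w | x < X w /\ x < Y w] / tail (df X) x.
have moo : m n @[n --> \oo] --> +oo.
  apply/cvgryPge => A; move/cvgryPge : uoo => /(_ A) uA.
  move/cvgryPge : voo => /(_ A) vA; near=> n.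
  by rewrite le_min; apply/andP; split; near: n.
have qm : q (m n) @[n --> \oo] --> (0 : R) by exact: (cvg_comp _ _ moo J).
have Mq : M * q (m n) @[n --> \oo] --> (0 : R).
  by rewrite -[0](mulr0 M); apply: cvgM => //; exact: cvg_cst.
apply: (squeeze_cvgr _ (cvg_cst _) Mq).
near=> n; rewrite mulr_ge0 ?prob_ge0//=.
have mJ x y : measurable [set w | x < X w /\ y < Y w].
  by apply: measurableI; exact: measurable_RV_gt.
have le_J : prob P [set w | u n < X w /\ v n < Y w] <=
            prob P [set w | m n < X w /\ m n < Y w].
  apply: le_prob => // w [uX vY].
  by split; rewrite (le_lt_trans _ uX, le_lt_trans _ vY)// ge_min lexx ?orbT.
(* The minimum is one of [u n] and [v n], so one of the two bounds applies directly. *)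
have mM : n%:R * tail (df X) (m n) <= M.
  by rewrite /m; case: (leP (u n) (v n)) => _; near: n.
rewrite (le_trans (ler_wpM2l _ le_J))//.
(* The joint probability is split into a bounded factor and the vanishing ratio [q (m n)]. *)
rewrite (_ : n%:R * _ = n%:R * tail (df X) (m n) * q (m n)); last first.
  by rewrite /q -mulrA [tail _ _ * _]mulrC divfK ?gt_eqF.
by rewrite ler_wpM2r// divr_ge0 ?prob_ge0// ltW.
Unshelve. all: by end_near. Qed.


(** * The Gumbel domain of attraction for both margins *)

(** Passes from the limit of [n] times the tail to the limit of powers: with [l = expR (- x)], the
    limit [expR (- l)] is the Gumbel law. *)
Lemma attracted_MDA_gumbel X :
  MDA_gumbel (df X) -> exists G a b, attracted (df X) G a b.
Proof.
move=> [_ [a [b [a0 ab]]]]; exists gumbel, a, b; split => //.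
- exists gumbel, 1, 0; split => //; first exact: Or31.
  by move=> x; rewrite subr0 divr1.
- move=> x.
  have := cvg_exprn_expR _ _ _ (fun n => tail_df_itv X (a n * x + b n)) (ab x).
  by under eq_cvg do rewrite /tail subKr.
Qed.

(** The ratio is positive at some [y >= x], and the tail at [x] is at least the tail at [y]. *)
Lemma tail_df_gt0_tail_ratio X Y (c : R) :
  0 < c -> (forall x, 0 < tail (df X) x) ->
  tail (df Y) x / tail (df X) x @[x --> +oo] --> c ->
  forall x, 0 < tail (df Y) x.
Proof.
move=> c0 tX YX x.
have : \forall y \near +oo, x <= y /\ 0 < tail (df Y) y / tail (df X) y.
  near=> y; split; near: y; last exact: (cvgr_gt c YX).
  by apply: nbhs_pinfty_ge; rewrite num_real.
move=> /filter_ex[y [xy]].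
rewrite pmulr_lgt0 ?invr_gt0// => /lt_le_trans; apply; exact: tail_df_anti.
Unshelve. all: by end_near. Qed.

Lemma MDA_gumbel_tail_ratio X Y (c : R) :
  0 < c -> (forall x, 0 < tail (df X) x) ->
  tail (df Y) x / tail (df X) x @[x --> +oo] --> c ->
  MDA_gumbel (df X) -> MDA_gumbel (df Y).
Proof.
move=> c0 tX YX [_ [a [b [a0 ab]]]]; split; first exact: df_distribution.
exists a, (fun n => a n * ln c + b n); split => // x.
pose u n := a n * (x + ln c) + b n.
have uoo : u n @[n --> \oo] --> +oo.
  apply: (cvg_pinfty_tail _ (df X)) => //.
    by have [] := df_distribution X.
  apply: (cvg_to0_bounded_natr _ _ (expR (- (x + ln c)) + 1)).
    by move=> n; have /andP[] := tail_df_itv X (u n).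
  exact/cvg_natrM_bounded/ab.
(* The shift by [ln c] divides the Gumbel limit by [c], which the limit of the tail ratio
   restores. *)
have -> : expR (- x) = expR (- (x + ln c)) * c.
  by rewrite opprD expRD expRN (expRN (ln c)) lnK// mulfVK// gt_eqF.
rewrite (_ : (fun n => _) = (fun n => n%:R * tail (df X) (u n)) \*
    (fun n => tail (df Y) (u n) / tail (df X) (u n))).
  by apply: cvgM; [exact: ab|exact: (cvg_comp _ _ uoo YX)].
apply/funext => n /=; rewrite -mulrA [tail (df X) _ * _]mulrC divfK ?gt_eqF//.
by rewrite /u [a n * (_ + _)]mulrDr addrA.
Qed.

(** * Convergence of powers of the joint distribution function *)

Lemma cvg_exprn_ge0 (u : nat -> R) (g : R) :
  (forall n, 0 <= u n) -> u n ^+ n @[n --> \oo] --> g -> 0 <= g.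
Proof.
move=> u0 ug; rewrite leNgt; apply/negP => /(cvgr_lt g ug)[n _ /(_ n (leqnn n))].
by rewrite /= ltNge exprn_ge0.
Qed.

(** Stated for arbitrary thresholds [u] and [v] with convergent powers, so that any norming
    constants and limit laws can be inserted. *)
Lemma cvg_joint_df_exprn X Y (c g1 g2 : R) (u v : nat -> R) :
  0 < c -> (forall x, 0 < tail (df X) x) ->
  tail (df Y) x / tail (df X) x @[x --> +oo] --> c ->
  prob P [set w | x < X w /\ x < Y w] / tail (df X) x @[x --> +oo] --> (0 : R) ->
  df X (u n) ^+ n @[n --> \oo] --> g1 ->
  df Y (v n) ^+ n @[n --> \oo] --> g2 ->
  joint_df X Y (u n) (v n) ^+ n @[n --> \oo] --> g1 * g2.
Proof.
move=> c0 tX YX J ug vg.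
have tY := tail_df_gt0_tail_ratio _ _ _ c0 tX YX.
have dfX01 n : 0 <= df X (u n) <= 1 by exact: df_itv.
have dfY01 n : 0 <= df Y (v n) <= 1 by exact: df_itv.
have g10 : 0 <= g1.
  by apply: (cvg_exprn_ge0 _ _ _ ug) => n; have /andP[] := dfX01 n.
have g20 : 0 <= g2.
  by apply: (cvg_exprn_ge0 _ _ _ vg) => n; have /andP[] := dfY01 n.
have [g1E|g1n0] := eqVneq g1 0.
  rewrite g1E mul0r; rewrite g1E in ug.
  apply: (squeeze_cvgr _ (cvg_cst _) ug); near=> n.
  have [H0 HX _] := joint_df_itv X Y (u n) (v n).
  by rewrite exprn_ge0//= lerXn2r// nnegrE (le_trans H0 HX).
have [g2E|g2n0] := eqVneq g2 0.
  rewrite g2E mulr0; rewrite g2E in vg.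
  apply: (squeeze_cvgr _ (cvg_cst _) vg); near=> n.
  have [H0 _ HY] := joint_df_itv X Y (u n) (v n).
  by rewrite exprn_ge0//= lerXn2r// nnegrE (le_trans H0 HY).
have g1p : 0 < g1 by rewrite lt_neqAle eq_sym g1n0.
have g2p : 0 < g2 by rewrite lt_neqAle eq_sym g2n0.
have bounded (Z : {RV P >-> R}) (w : nat -> R) (g : R) :
    0 < g -> df Z (w n) ^+ n @[n --> \oo] --> g ->
    exists M, \forall n \near \oo, n%:R * tail (df Z) (w n) <= M.
  move=> gp wg; apply: (natrM_bounded_of_cvg_exprn _ _ g _ gp).
    by move=> n; exact: tail_df_itv.
  by under eq_cvg do rewrite /tail subKr.
have tail_to0 (Z : {RV P >-> R}) (w : nat -> R) (M : R) :
    (\forall n \near \oo, n%:R * tail (df Z) (w n) <= M) ->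
    tail (df Z) (w n) @[n --> \oo] --> (0 : R).
  by apply: cvg_to0_bounded_natr => n; have /andP[] := tail_df_itv Z (w n).
have [M1 uM] := bounded _ _ _ g1p ug.
have [M2 vM] := bounded _ _ _ g2p vg.
have to_oo (Z : {RV P >-> R}) (w : nat -> R) : (forall x, 0 < tail (df Z) x) ->
    tail (df Z) (w n) @[n --> \oo] --> (0 : R) -> w n @[n --> \oo] --> +oo.
  by move=> tZ; apply: cvg_pinfty_tail => //; have [] := df_distribution Z.
have voo := to_oo _ _ tY (tail_to0 _ _ _ vM).
have uoo := to_oo _ _ tX (tail_to0 _ _ _ uM).
(* The joint tail is controlled relative to the tail of [X], so the bound at [v n] is moved from [Y]
   to [X]: eventually the tail ratio is at least [c / 2]. *)
have vXM : \forall n \near \oo, n%:R * tail (df X) (v n) <= 2 / c * M2.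
  have : \forall x \near +oo, c / 2 <= tail (df Y) x / tail (df X) x.
    by apply: (cvgr_ge c YX); lra.
  move/voo => /= YXv; near=> n.
  have nM : n%:R * tail (df Y) (v n) <= M2 by near: n.
  have c20 : 0 < 2 / c by rewrite divr_gt0.
  rewrite (le_trans _ (ler_wpM2l (ltW c20) nM))// mulrCA ler_wpM2l//.
  rewrite -invf_div ler_pdivlMl ?divr_gt0//.
  by rewrite -ler_pdivlMr//; near: n.
pose M := Num.max M1 (2 / c * M2).
have nJ : n%:R * prob P [set w | u n < X w /\ v n < Y w] @[n --> \oo] --> (0 : R).
  apply: (joint_tail_natrM_cvg0 _ _ _ _ M tX J uoo voo).
    by apply: filterS uM => n h; rewrite le_max h.
  by apply: filterS vXM => n h; rewrite le_max h orbT.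
(* This majorizes the difference of powers; its second term bounds [n] times the product of the two
   tails. *)
have bd : n%:R * prob P [set w | u n < X w /\ v n < Y w] + M1 * tail (df Y) (v n)
    @[n --> \oo] --> (0 : R).
  rewrite -[0]addr0; apply: cvgD => //; rewrite -[0](mulr0 M1).
  by apply: cvgM; [exact: cvg_cst|exact: (tail_to0 _ _ _ vM)].
have d0 : joint_df X Y (u n) (v n) ^+ n - (df X (u n) * df Y (v n)) ^+ n
    @[n --> \oo] --> (0 : R).
  apply: norm_cvg0; apply: (squeeze_cvgr _ (cvg_cst _) bd); near=> n.
  rewrite normr_ge0/=.
  have /andP[X0 X1] := dfX01 n; have /andP[Y0 Y1] := dfY01 n.
  have [H0 HX _] := joint_df_itv X Y (u n) (v n).
  rewrite (le_trans (ler_norm_subXX _ _ _ _ _ _))//.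
  - by rewrite H0 (le_trans HX).
  - by rewrite mulr_ge0//= mulr_ile1.
  (* By inclusion-exclusion, the defect from independence is the same for upper tails as for
     distribution functions. *)
  have -> : joint_df X Y (u n) (v n) - df X (u n) * df Y (v n) =
      prob P [set w | u n < X w /\ v n < Y w]
      - tail (df X) (u n) * tail (df Y) (v n).
    by rewrite joint_df_inclusion_exclusion /tail; ring.
  have tX0 := tX (u n); have tY0 := tY (v n).
  rewrite (le_trans (ler_wpM2l _ (ler_normB _ _)))// mulrDr.
  rewrite (ger0_norm (prob_ge0 _)) ger0_norm ?mulr_ge0 ?(ltW tX0) ?(ltW tY0)//.
  by rewrite lerD2l mulrA ler_wpM2r// ?(ltW tY0)//; near: n.
rewrite -[g1 * g2]add0r.
rewrite (_ : (fun n => _) = (fun n =>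
    (joint_df X Y (u n) (v n) ^+ n - (df X (u n) * df Y (v n)) ^+ n)
    + df X (u n) ^+ n * df Y (v n) ^+ n)); last first.
  by apply/funext => n; rewrite exprMn subrK.
by apply: cvgD => //; exact: cvgM.
Unshelve. all: by end_near. Qed.

End RandomPair.

Theorem mainTheorem7 (R : realType) (d : measure_display)
  (T : measurableType d) (P : probability T R) (X Y : {RV P >-> R})
  (f : R -> R) (c : R)
  (endpoint_F : right_endpoint (df X) = +oo%E)
  (MDA_F : MDA_gumbel (df X))
  (aux_f : auxiliary_function (df X) f)
  (c_gt0 : 0 < c)
  (tail_ratio : tail (df Y) x / tail (df X) x @[x --> +oo] --> c)
  (Y_given_X : forall t : R, 0 < t ->
     cond_prob P [set w | t * f x < `|Y w|] [set w | x < X w]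
       @[x --> +oo] --> (0 : R))
  (X_given_Y : forall t : R, 0 < t ->
     cond_prob P [set w | t * f x < `|X w|] [set w | x < Y w]
       @[x --> +oo] --> (0 : R))
  (joint_tail : exists2 L : R, 0 < L &
     prob P [set w | L * f x < Y w /\ L * f x < X w] / prob P [set w | x < X w]
       @[x --> +oo] --> (0 : R)) :
  [/\ MDA_gumbel (df X), MDA_gumbel (df Y) & asymptotically_independent X Y].
Proof.
have dfX_nd : {homo df X : x y / x <= y} by have [] := df_distribution _ _ _ _ X.
have tX := tail_gt0_right_endpoint _ _ dfX_nd endpoint_F.
have MDA_G := MDA_gumbel_tail_ratio _ _ _ _ _ _ _ c_gt0 tX tail_ratio MDA_F.
have [_ f_derivable f'0 _ _] := aux_f.
(* The factor 1 matches the conditional hypothesis at [t = 1]. *)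
have J := joint_tail_negligible _ _ _ _ X Y (fun x => 1 * f x).
split => //; split; [exact: attracted_MDA_gumbel..|].
move=> G1 G2 a1 b1 a2 b2 [_ _ XG1] [_ _ YG2] x1 x2.
apply: (cvg_joint_df_exprn _ _ _ _ _ _ _ _ _ _ _ c_gt0 tX tail_ratio).
- apply: J; last exact: Y_given_X.
  by apply: filterS (le_id_derive1_cvg0 _ _ f_derivable f'0) => x; rewrite mul1r.
- exact: XG1.
- exact: YG2.
Qed.
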